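(* Let $h\geq 2$, and let $\mathbf{b}=(b_1,\ldots,b_h)$ be a vector of positive integers with $\gcd(b_1,\ldots,b_h)=1$. Suppose that, after permuting the coefficients $b_1,\ldots,b_h$, there exist a prime $p$ and an integer $d\geq 1$ such that $$v_p(b_i)\equiv (i-1)d\pmod{hd}\qquad(1\leq i\leq h).$$ Then there exist a set $A\subseteq\mathbb{N}$ and a constant $C_{\mathbf{b}}>0$ depending only on $\mathbf{b}$ such that, for every sufficiently large integer $n$, $$1\leq r_{A,\mathbf{b}}(n)\leq C_{\mathbf{b}}.$$
   Context: $\mathbb{N}=\mathbb{Z}_{\geq 0}$. For $A\subseteq\mathbb{N}$ and $\mathbf{b}=(b_1,\ldots,b_h)$ a vector of positive integers, the representation function is $$r_{A,\mathbf{b}}(n):=\#\{(x_1,\ldots,x_h)\in A^h \mid b_1x_1+\cdots+b_hx_h=n\}.$$ For a prime $p$ and $n\neq 0$, $v_p(n)$ denotes the largest $k\geq 0$ such that $p^k\mid n$. *)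

(* Defs.v *)
From mathcomp Require Import all_boot all_order finmap.
From mathcomp Require Import boolp classical_sets functions cardinality.

Set Implicit Arguments.
Unset Strict Implicit.
Unset Printing Implicit Defensive.

Local Open Scope classical_set_scope.
Local Open Scope fset_scope.

Definition representations (A : set nat) (h : nat) (b : 'I_h -> nat) (n : nat)
    : set {ffun 'I_h -> nat} :=
  [set x | (forall i, A (x i)) /\ (\sum_(i < h) b i * x i)%N = n].

(* [fset_set] returns the empty set on infinite sets; this cannot occur for
   positive coefficients, by [finite_representations]. *)
Definition repr_fun (A : set nat) (h : nat) (b : 'I_h -> nat) (n : nat) : nat :=
  #|` fset_set (representations A b n)|.

Lemma finite_representations (A : set nat) (h : nat) (b : 'I_h -> nat)
    (n : nat) :
  (forall i, 0 < b i)%N -> finite_set (representations A b n).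
Proof.
move=> b_gt0.
pose f (y : {ffun 'I_h -> 'I_n.+1}) := [ffun i => nat_of_ord (y i)].
apply: (@sub_finite_set _ _ (f @` setT)); last first.
  exact/finite_image/finite_finset.
move=> x [_ sum_x]; exists [ffun i => inord (x i)] => //.
apply/ffunP => i; rewrite !ffunE inordK // ltnS -sum_x (bigD1 i) //=.
by rewrite (leq_trans _ (leq_addr _ _)) // leq_pmull.
Qed.

(* Main.v *)
Require Import Defs.
From mathcomp Require Import all_boot all_order all_fingroup all_algebra.
From mathcomp Require Import finmap boolp classical_sets cardinality.
(* [fintype] and [finset] come last so that their [subsetP], [set0], ... take
   precedence over those of [classical_sets]. *)
From mathcomp Require Import zify fintype finset.

Import GRing.Theory.
Set Implicit Arguments.
Unset Strict Implicit.
Unset Printing Implicit Defensive.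

(** Let q = p^d and Q = q^h, and let A0 be the set of integers whose base-Q
    digits are all < q. Distinct elements of A0 differ by an integer whose
    p-adic valuation lies in [0, d) modulo hd, so by the hypothesis on b the
    map x |-> sum b_i x_i is injective on products of dilated translates
    g_i A0 + t_i with p not dividing g_i. Hence the representation function of
    any finite union A of sets g A0 + t, p not dividing g, is bounded.

    For the lower bound, S = sum b_i A0 satisfies S = Q S + D with D finite, and
    S has at least Q^k elements below (sum b_i) Q^k. By a density argument S
    therefore has bounded gaps on some intervals [Q^k y, Q^k (y + 1)), with y
    fixed and k arbitrary. Dilating by finitely many g prime to p covers all
    scales: every large n is g s + r with s in S and r bounded. Finally r can be
    written as sum b_i t_i because gcd(b_i) = 1, once it is large enough, which
    is arranged by first subtracting a constant from n. *)

(** * Self-similar sets: windows and bounded gaps *)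

(** Bernoulli's inequality [(1 + 1/a)^k >= 1 + k/a], cleared of denominators, at [k = c * a]. *)
Lemma expn_gt_mul_exp (a c : nat) : exists k, c * a ^ k < a.+1 ^ k.
Proof.
have bernoulli k : a ^ k * (a + k) <= a.+1 ^ k * a.
  elim: k => [|k IHk]; first by rewrite !expn0 !mul1n addn0.
  have := leq_mul (leqnn a.+1) IHk; rewrite !expnS.
  suff : a * a ^ k * (a + k.+1) <= a.+1 * (a ^ k * (a + k)) by lia.
  by move: (a ^ k) => u; nia.
have [->|a_gt0] := posnP a; first by exists 1; rewrite muln0.
exists (c * a); have := bernoulli (c * a).
have : 0 < a ^ (c * a) by rewrite expn_gt0 a_gt0.
move: (a ^ _) (a.+1 ^ _) => u v; nia.
Qed.

Lemma sum_nat_mul_blocks (m R : nat) (F : nat -> nat) :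
  \sum_(z < m * R) F z = \sum_(y < m) \sum_(r < R) F (R * y + r).
Proof.
elim: m => [|m IHm]; first by rewrite !big_ord0.
rewrite big_ord_recr /= -IHm mulSn addnC -!(big_mkord xpredT).
rewrite (@big_cat_nat _ _ _ (m * R)) ?leq_addr //=; congr (_ + _).
rewrite -{1}[m * R]add0n [m * R + R]addnC big_addn addnK big_mkord.
by apply: eq_bigr => i _; rewrite addnC mulnC.
Qed.

(* [y] is dead when [window U S y] is empty, i.e. [S] misses [y - U, y]. The
   window of [y] determines the windows of all its base-[Q] descendants
   [Q ^ N * y + r], [r < Q ^ N], and descendants of dead points are dead. *)
Definition window (U : nat) (S : set nat) (y : nat) : {set 'I_U.+1} :=
  [set j : 'I_U.+1 | (j <= y) && `[< S (y - j) >]].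

Lemma windowP (U : nat) (S : set nat) (y : nat) (j : 'I_U.+1) :
  reflect (exists2 s, S s & y = s + j) (j \in window U S y).
Proof.
rewrite inE; apply: (iffP andP) => [[ley /asboolP Ss]|[s Ss ->]].
  by exists (y - j); rewrite ?subnK.
by rewrite leq_addl addnK; split=> //; apply/asboolP.
Qed.

Definition self_similar (Q : nat) (D S : set nat) : Prop :=
  forall x, S x <-> exists s e, [/\ S s, D e & x = Q * s + e].

(** From [Q * s + e + j = Q * y + r] follows [Q * (y - s) <= e + j <= U * Q]: the bound on [D] keeps
    the offset of the parent within [U]. *)
Lemma window_parent (Q U : nat) (D S : set nat) (y r : nat) (j : 'I_U.+1) :
  self_similar Q D S -> (forall e, D e -> e <= U * Q.-1) -> r < Q ->
  j \in window U S (Q * y + r) ->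
  exists (i : 'I_U.+1) (e : nat),
    [/\ i \in window U S y, D e & Q * i + r = e + j].
Proof.
move=> selfS leD ltrQ /windowP [x /selfS [s [e [Ss De ->]]] eqy].
have le_e := leD _ De; have lt_j := ltn_ord j.
have le_sy : s <= y by nia.
have lt_i : y - s < U.+1 by nia.
exists (Ordinal lt_i), e; split=> //=; last by nia.
by apply/windowP; exists s => //=; rewrite subnKC.
Qed.

Lemma window_child (Q U : nat) (D S : set nat) (y y' r : nat) :
  self_similar Q D S -> (forall e, D e -> e <= U * Q.-1) -> r < Q ->
  window U S y \subset window U S y' ->
  window U S (Q * y + r) \subset window U S (Q * y' + r).
Proof.
move=> selfS leD ltrQ /subsetP sub; apply/subsetP => j.
case/(window_parent selfS leD ltrQ) => i [e [/sub /windowP [s Ss ->] De eqe]].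
apply/windowP; exists (Q * s + e); first by apply/selfS; exists s, e.
by rewrite mulnDr -!addnA eqe.
Qed.

Lemma window_descendant (Q U N : nat) (D S : set nat) (y y' r : nat) :
  self_similar Q D S -> (forall e, D e -> e <= U * Q.-1) -> r < Q ^ N ->
  window U S y \subset window U S y' ->
  window U S (Q ^ N * y + r) \subset window U S (Q ^ N * y' + r).
Proof.
move=> selfS leD + sub; elim: N r => [|N IHN] r.
  by rewrite expn0 ltnS leqn0 !mul1n => /eqP ->; rewrite !addn0.
move=> lt_r; have Q_gt0 : 0 < Q by case: Q lt_r {IHN selfS leD} => //; rewrite exp0n.
rewrite {1 2}(divn_eq r Q) expnS -!mulnA [_ %/ Q * Q]mulnC !addnA -!mulnDr.
apply: (window_child selfS leD); first by rewrite ltn_mod.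
by apply: IHN; rewrite ltn_divLR // mulnC -expnS.
Qed.

Lemma window_dead (Q U N : nat) (D S : set nat) (y r : nat) :
  self_similar Q D S -> (forall e, D e -> e <= U * Q.-1) -> r < Q ^ N ->
  window U S y = set0 -> window U S (Q ^ N * y + r) = set0.
Proof.
move=> selfS leD + dead; elim: N r => [|N IHN] r.
  by rewrite expn0 ltnS leqn0 mul1n => /eqP ->; rewrite addn0.
move=> lt_r; have Q_gt0 : 0 < Q by case: Q lt_r {IHN selfS leD} => //; rewrite exp0n.
rewrite (divn_eq r Q) expnS -!mulnA [_ %/ Q * Q]mulnC !addnA -!mulnDr.
apply/setP => j; rewrite in_set0; apply/negP.
have lt_mod : r %% Q < Q by rewrite ltn_mod.
case/(window_parent selfS leD lt_mod) => i [e []].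
by rewrite IHN ?in_set0 // ltn_divLR // mulnC -expnS.
Qed.

(* If every [y] had a dead descendant then, there being finitely many windows,
   one depth [M] would work for all [y]; each passage to depth [M] would then
   lose a proportion [Q ^ - M] of the live points, which would leave fewer than
   the [Q ^ k] points of [S] below [U * Q ^ k]. *)
Lemma self_similar_syndetic_window (Q U : nat) (D S : set nat) :
  1 < Q -> self_similar Q D S -> (forall e, D e -> e <= U * Q.-1) ->
  (forall k, exists f : 'I_(Q ^ k) -> nat,
     injective f /\ forall i, S (f i) /\ f i < U * Q ^ k) ->
  exists2 y, 0 < y & forall N z, Q ^ N * y <= z < Q ^ N * y.+1 ->
    exists2 s, S s & s <= z <= s + U.
Proof.
move=> Q_gt1 selfS leD largeS; have Q_gt0 := ltnW Q_gt1.
pose W := window U S.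
have [[y live]|] := pselect (exists y, forall N r, r < Q ^ N -> W (Q ^ N * y + r) != set0).
  (* This descendant of [y] is positive even when [y = 0]. *)
  exists (Q * y + 1) => [|N z /andP [le_z lt_z]]; first by rewrite addn1.
  have : W (Q ^ N.+1 * y + (z - Q ^ N.+1 * y)) != set0.
    apply: live; move: le_z lt_z; rewrite expnS.
    have : 0 < Q ^ N by rewrite expn_gt0 Q_gt0.
    by move: (Q ^ N) => u; nia.
  rewrite subnKC; last by move: le_z; rewrite expnS; move: (Q ^ N) => u; nia.
  case/set0Pn => j /windowP [s Ss ->]; exists s => //.
  by rewrite leq_addr leq_add2l -ltnS ltn_ord.
move=> /forallNP all_die.
have die y : exists N r, r < Q ^ N /\ W (Q ^ N * y + r) = set0.
  apply: contra_notP (all_die y) => /forallNP nodie N r lt_r.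
  by apply/eqP => dead; apply: (nodie N); exists r.
have /choice [N dieN] (P : {set 'I_U.+1}) :
    exists N, forall y, W y = P -> exists2 r, r < Q ^ N & W (Q ^ N * y + r) = set0.
  have [[y eqy]|] := pselect (exists y, W y = P); last first.
    by move=> noy; exists 0 => y eqy; case: noy; exists y.
  have [N [r [lt_r dead]]] := die y; exists N => y' eqy'; exists r => //.
  apply/eqP; rewrite -subset0 -dead.
  by apply: (window_descendant selfS leD lt_r); rewrite -/(W y') eqy' -eqy.
pose M := \max_P N P; pose R := Q ^ M.
have dieM y : exists r : 'I_R, W (R * y + r) = set0.
  have [r lt_r dead] := dieN (W y) y erefl.
  have leM : N (W y) <= M by exact: leq_bigmax.
  have eqR : R = Q ^ (M - N (W y)) * Q ^ N (W y) by rewrite -expnD subnK.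
  have gt0 : 0 < Q ^ (M - N (W y)) by rewrite expn_gt0 Q_gt0.
  (* Appending [M - N (W y)] zero digits to a dead descendant reaches depth [M], and the result is
     still dead. *)
  have lt : Q ^ (M - N (W y)) * r < R by rewrite eqR ltn_pmul2l.
  exists (Ordinal lt) => /=; rewrite eqR -mulnA -mulnDr -[X in W X]addn0.
  exact: (window_dead selfS leD).
pose live z : nat := W z != set0.
have count k : \sum_(z < U * R ^ k) live z <= U * R.-1 ^ k.
  elim: k => [|k IHk].
    rewrite !expn0 -[X in _ <= X]card_ord -sum1_card leq_sum // => i _.
    exact: leq_b1.
  rewrite expnSr mulnA sum_nat_mul_blocks.
  apply: leq_trans (_ : \sum_(y < U * R ^ k) live y * R.-1 <= _); last first.
    by rewrite -big_distrl /= expnSr mulnA leq_mul2r IHk orbT.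
  apply: leq_sum => y _.
  rewrite /live; have [dead|liv] := eqVneq (W y) set0.
    rewrite mul0n leqn0 sum_nat_eq0; apply/forall_inP => r _.
    have -> : W (R * y + r) = set0 by exact: (window_dead selfS leD).
    by rewrite eqxx.
  rewrite mul1n; have [r dead] := dieM y.
  rewrite (bigD1 r) //= dead eqxx add0n.
  apply: leq_trans (_ : \sum_(i < R | i != r) 1 <= _).
    by apply: leq_sum => i _; exact: leq_b1.
  by rewrite sum1_card cardC1 card_ord.
have [k ltk] := expn_gt_mul_exp R.-1 U.
have R_gt0 : 0 < R by rewrite expn_gt0 Q_gt0.
have := leq_ltn_trans (count k) ltk; rewrite prednK // ltnNge => /negP; case.
have [f [f_inj Sf]] := largeS (M * k).
rewrite /R -!expnM.
pose F i : 'I_(U * Q ^ (M * k)) := Ordinal (Sf i).2.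
have F_inj : injective F by move=> i j [] /f_inj.
rewrite -[X in X <= _]card_ord -(card_codom F_inj) -sum1_card big_mkcond /=.
apply: leq_sum => z _; case: ifP => // /codomP [i ->].
(* A point of [S] is live, being in its own window at offset 0. *)
rewrite lt0b; apply/set0Pn; exists ord0; apply/windowP.
by exists (f i); rewrite ?addn0 //; have [] := Sf i.
Qed.

(** * Integers with small digits, and valuations of their differences *)

(** Rereads the [k] lowest base-[q] digits of [n] as digits in base [Q]. *)
Fixpoint spread (q Q k n : nat) : nat :=
  if k is k'.+1 then n %% q + Q * spread q Q k' (n %/ q) else 0.

Definition lacunary (q Q : nat) : set nat :=
  [set x | exists k n, x = spread q Q k n].

Lemma lacunary_digit (q Q x : nat) : 0 < q ->
  lacunary q Q x <->
  exists a c, [/\ lacunary q Q a, c < q & x = Q * a + c].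
Proof.
move=> q_gt0; split=> [[[|k] [n ->]]|[_ [c [[k [n ->]] lt_c ->]]]] /=.
- by exists 0, 0; split=> //; [exists 0, 0 | rewrite muln0].
- exists (spread q Q k (n %/ q)), (n %% q); rewrite ltn_mod addnC.
  by split=> //; exists k, (n %/ q).
exists k.+1, (n * q + c) => /=.
by rewrite modnMDl divnMDl // modn_small // divn_small // addn0 addnC.
Qed.

Lemma spread_lt (q Q k n : nat) : 0 < q -> q <= Q -> spread q Q k n < Q ^ k.
Proof.
move=> q_gt0 leqQ; elim: k n => [|k IHk] n //=.
have := ltn_pmod n q_gt0; have := IHk (n %/ q); rewrite expnS; nia.
Qed.

Lemma spread_inj (q Q k m n : nat) : 0 < q -> q <= Q ->
  m < q ^ k -> n < q ^ k -> spread q Q k m = spread q Q k n -> m = n.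
Proof.
move=> q_gt0 leqQ; elim: k m n => [|k IHk] m n /=.
  by rewrite expn0 !ltnS !leqn0 => /eqP -> /eqP ->.
rewrite expnSr -!ltn_divLR // => lt_m lt_n eq_s.
have lt_mod u : u %% q < Q by apply: leq_trans leqQ; rewrite ltn_mod.
have Q_gt0 := leq_trans q_gt0 leqQ.
have eq_mod : m %% q = n %% q.
  have /= := congr1 (modn^~ Q) eq_s.
  by rewrite !(mulnC Q) ![_ %% q + _]addnC !modnMDl !(modn_small (lt_mod _)).
rewrite (divn_eq m q) (divn_eq n q) eq_mod; congr (_ * _ + _).
apply: IHk => //; apply/eqP; rewrite -(eqn_pmul2l Q_gt0); apply/eqP.
by move: eq_s; rewrite eq_mod => /addnI.
Qed.

Definition separated (p d e : nat) (A : set nat) : Prop :=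
  forall x y, A x -> A y -> x <> y -> logn p (absz (x%:Z - y%:Z)%R) %% e < d.

Lemma absz_sub_gt0 (x y : nat) : x <> y -> 0 < absz (x%:Z - y%:Z)%R.
Proof. lia. Qed.

(** Equal last base-[Q] digits are stripped off, each lowering the valuation by [h * d]. Once the
    last digits differ, being below [p ^ d] they differ modulo [p ^ d], so the valuation is below
    [d]. *)
Lemma lacunary_separated (p d h : nat) : prime p -> 0 < d -> 0 < h ->
  separated p d (h * d) (lacunary (p ^ d) (p ^ (h * d))).
Proof.
move=> p_pr d_gt0 h_gt0 x y.
have p_gt0 := prime_gt0 p_pr; have p_gt1 := prime_gt1 p_pr.
set q := p ^ d; set Q := p ^ (h * d).
have q_gt0 : 0 < q by rewrite expn_gt0 p_gt0.
have Q_gt1 : 1 < Q by rewrite -(exp1n (h * d)) ltn_exp2r // muln_gt0 h_gt0.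
have [m] := ubnP (x + y); elim: m x y => // m IHm x y /ltnSE le_m.
move=> /(lacunary_digit Q _ q_gt0) [a [c [Aa lt_c eqx]]].
move=> /(lacunary_digit Q _ q_gt0) [a' [c' [Aa' lt_c' eqy]]] neq.
have [eqc|neqc] := eqVneq c c'.
  have neqa : a <> a' by move=> eqa; apply: neq; rewrite eqx eqy eqa eqc.
  have -> : (x%:Z - y%:Z = Q%:Z * (a%:Z - a'%:Z))%R by rewrite eqx eqy eqc; lia.
  rewrite abszM lognM ?absz_sub_gt0 //; last exact: ltnW.
  rewrite [absz Q]/= pfactorK // modnDl.
  apply: IHm => //; apply: leq_trans le_m; rewrite eqx eqy.
  by clear -neqa Q_gt1; clearbody Q; nia.
have lt_v : logn p (absz (x%:Z - y%:Z)%R) < d.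
  rewrite ltnNge -pfactor_dvdn ?absz_sub_gt0 //; apply/negP => dvd_q.
  move/eqP: neqc; apply; rewrite -(modn_small lt_c) -(modn_small lt_c').
  have qQ : q %| Q by rewrite dvdn_exp2l // leq_pmull.
  have [Q' eqQ] := dvdnP qQ.
  have red u v : (Q * u + v) %% q = v %% q by rewrite eqQ mulnAC modnMDl.
  rewrite -(red a c) -(red a' c') -eqx -eqy.
  wlog le_yx : x y {eqx eqy neq le_m} dvd_q / y <= x => [H|].
    have [/H -> //|/ltnW /H -> //] := leqP y x.
    by rewrite distnC in dvd_q.
  by apply/eqP; rewrite eqn_mod_dvd // -distnEl.
by rewrite modn_small // (leq_trans lt_v) // leq_pmull.
Qed.

Lemma separated_affine (p d e g t : nat) (A : set nat) :
  0 < g -> coprime p g -> separated p d e A ->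
  separated p d e [set x | exists2 a, A a & x = g * a + t].
Proof.
move=> g_gt0 cop sepA _ _ [a Aa ->] [b Ab ->] neq.
have neqab : a <> b by move=> eqab; apply: neq; rewrite eqab.
have -> : ((g * a + t)%N%:Z - (g * b + t)%N%:Z = g%:Z * (a%:Z - b%:Z))%R by lia.
rewrite abszM lognM ?absz_sub_gt0 // logn_coprime //; exact: sepA.
Qed.

(* The [i]-th summand of the difference has valuation in the residue classes
   [w i * d, w i * d + d) modulo [h * d], so nonzero summands have pairwise
   distinct valuations and cannot cancel. *)
Lemma separated_linear_form_inj (p d h : nat) (b : 'I_h -> nat)
    (w : 'I_h -> 'I_h) (A : 'I_h -> set nat) (x y : 'I_h -> nat) :
  prime p -> 0 < d -> (forall i, 0 < b i) -> injective w ->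
  (forall i, logn p (b i) = w i * d %[mod h * d]) ->
  (forall i, separated p d (h * d) (A i)) ->
  (forall i, A i (x i)) -> (forall i, A i (y i)) ->
  \sum_(i < h) b i * x i = \sum_(i < h) b i * y i -> x =1 y.
Proof.
move=> p_pr d_gt0 b_gt0 w_inj vb sepA Ax Ay eq_sum.
pose z i : int := ((b i)%:Z * ((x i)%:Z - (y i)%:Z))%R.
pose v i := logn p (absz (z i)).
have z_gt0 i : x i != y i -> 0 < absz (z i).
  by move/eqP => neq; rewrite abszM muln_gt0 b_gt0 absz_sub_gt0.
have vP i : x i != y i -> v i %% (h * d) %/ d = w i.
  move/eqP => neq; rewrite /v /z abszM lognM ?b_gt0 ?absz_sub_gt0 //.
  have := sepA i _ _ (Ax i) (Ay i) neq.
  rewrite -modnDm vb; set r := _ %% _ => lt_r.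
  have lt_w : w i * d + r < h * d.
    by apply: leq_trans (_ : (w i).+1 * d <= _); [lia | rewrite leq_mul2r ltn_ord orbT].
  rewrite [w i * d %% _]modn_small; last by rewrite (leq_ltn_trans _ lt_w) ?leq_addr.
  by rewrite modn_small // divnMDl // divn_small // addn0.
have v_inj i j : x i != y i -> x j != y j -> v i = v j -> i = j.
  by move=> ni nj eqv; apply: w_inj; apply: val_inj; rewrite /= -(vP i ni) -(vP j nj) eqv.
have sum0 : (\sum_(i < h) z i = 0)%R.
  rewrite (eq_bigr (fun i => (b i * x i)%N%:Z - (b i * y i)%N%:Z)%R); last first.
    by move=> i _; rewrite /z mulrBr !PoszM.
  by rewrite sumrB -!(big_morph Posz PoszD (erefl 0%Z)) eq_sum subrr.
move=> i0; apply/eqP; apply/negPn/negP => neq0.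
(* At an [i] of least valuation all other terms are divisible by [p ^ (v i).+1]; as the sum
   vanishes, so is [z i], a contradiction. *)
have [i neqi min_i] := @arg_minnP _ i0 (fun i => x i != y i) v neq0.
have : (p ^ (v i).+1 %| absz (z i))%N.
  rewrite -[X in _ %| X]abszN; move: sum0; rewrite (bigD1 i) //= addrC => /eqP.
  rewrite addr_eq0 => /eqP <-.
  suff : ((p ^ (v i).+1)%:Z %| (\sum_(j < h | j != i) z j)%R)%Z by [].
  apply: rpred_sum => j neqj; rewrite dvdzE /=.
  have [eqj|neq] := eqVneq (x j) (y j); first by rewrite /z eqj subrr mulr0.
  rewrite pfactor_dvdn ?z_gt0 // ltn_neqAle min_i // andbT.
  by apply: contra_neq neqj => /(v_inj _ _ neqi neq).
by rewrite pfactor_dvdn ?z_gt0 // ltnn.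
Qed.

(** * Arithmetic of coefficients and dilations *)

(** With Bezout coefficients [c i] and [U] the sum of the [b i], the solution
    [t i = m %/ U + (m %% U) * c i] is nonnegative once [m %/ U] is at least [U] times the largest
    [|c i|]. *)
Lemma gcd_frobenius (h : nat) (b : 'I_h -> nat) :
  (forall i, 0 < b i) -> \big[gcdn/0]_(i < h) b i = 1 ->
  exists M, forall m, M <= m -> exists t : 'I_h -> nat, \sum_(i < h) b i * t i = m.
Proof.
move=> b_gt0 gcd1.
have [c sumc] : exists c : 'I_h -> int, (\sum_(i < h) (b i)%:Z * c i = 1)%R.
  suff : exists c : 'I_h -> int,
      (\sum_(i < h) (b i)%:Z * c i = Posz (\big[gcdn/0]_(i < h) b i)%N)%R by rewrite gcd1.
  elim/big_ind: _ => [|m n [c eqc] [e eqe]|i _].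
  - by exists (fun=> 0%R); rewrite big1 // => i _; rewrite mulr0.
  - have [u [v eqg]] := Bezoutz m n.
    exists (fun i => c i * u + e i * v)%R.
    under eq_bigr do rewrite mulrDr !mulrA.
    by rewrite big_split -!mulr_suml eqc eqe /= ![(_%:Z * _)%R]mulrC eqg.
  - exists (fun j => Posz (j == i)); rewrite (bigD1 i) //= eqxx mulr1 big1 ?addr0 //.
    by move=> j /negPf ->; rewrite mulr0.
pose U := \sum_(i < h) b i; pose K := \max_(i < h) absz (c i).
exists (U * (U * K)) => m le_m.
have U_gt0 : 0 < U.
  rewrite lt0n; apply: contra_eq_neq sumc; rewrite /U => /eqP.
  rewrite sum_nat_eq0 => /forall_inP b0.
  by rewrite big1 // => i _; move: (b_gt0 i); rewrite (eqP (b0 i isT)).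
have le_k : U * K <= m %/ U by rewrite leq_divRL // mulnC.
have t_ge0 i : (0 <= (m %/ U)%:Z + (m %% U)%:Z * c i)%R.
  have : absz (c i) <= K by exact: leq_bigmax.
  have := ltn_pmod m U_gt0; move: le_k; nia.
exists (fun i => absz ((m %/ U)%:Z + (m %% U)%:Z * c i)%R).
apply/eqP; rewrite -eqz_nat (big_morph Posz PoszD (erefl 0%Z)).
under eq_bigr => i _ do rewrite PoszM gez0_abs // mulrDr mulrCA.
rewrite big_split -mulr_suml -mulr_sumr sumc mulr1 /=.
by rewrite -(big_morph Posz PoszD (erefl 0%Z)) -PoszM -PoszD mulnC -divn_eq.
Qed.

(* One of [w %/ y] and its predecessor is prime to [p]. *)
Lemma coprime_dilation (p y w : nat) : prime p -> 0 < y -> y * (2 * y).+1 <= w ->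
  exists g, [/\ 0 < g, coprime p g, g <= w & g * y <= w < g * y.+1].
Proof.
move=> p_pr y_gt0 le_w; pose g := w %/ y.
(* This leaves room for the predecessor: [(g - 1) * (y + 1) >= g * y + y > w]. *)
have le_g : (2 * y).+1 <= g by rewrite leq_divRL // mulnC.
have := divn_eq w y; have := ltn_pmod w y_gt0; rewrite -/g => lt_m eqw.
have [dvdg|ndvdg] := boolP (p %| g); last first.
  by exists g; rewrite prime_coprime //; split=> //; nia.
exists g.-1; rewrite prime_coprime //; split; [lia| |nia|nia].
apply/negP => dvdg1; have : p %| 1.
  by rewrite -(dvdn_addr 1 dvdg1) addn1 prednK //; lia.
by rewrite dvdn1 => /eqP p1; rewrite p1 in p_pr.
Qed.

(** * Values of the linear form on integers with small digits *)

Definition form_values (h : nat) (b : 'I_h -> nat) (A : set nat) : set nat :=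
  [set x | exists2 a : 'I_h -> nat, forall i, A (a i) & x = \sum_(i < h) b i * a i].

Lemma lacunary_form_self_similar (h q Q : nat) (b : 'I_h -> nat) : 0 < q ->
  self_similar Q (form_values b (fun c => c < q)) (form_values b (lacunary q Q)).
Proof.
move=> q_gt0 x; split=> [[a La ->]|[_ [_ [[a La ->] [c lt_c ->] ->]]]].
  have /choice [u] i : exists u : nat * nat,
      [/\ lacunary q Q u.1, u.2 < q & a i = Q * u.1 + u.2].
    by have [u [c P]] := (lacunary_digit Q (a i) q_gt0).1 (La i); exists (u, c).
  move=> P; exists (\sum_(i < h) b i * (u i).1), (\sum_(i < h) b i * (u i).2).
  split; [by exists (fun i => (u i).1) => // i; case: (P i)
         |by exists (fun i => (u i).2) => // i; case: (P i)|].
  rewrite big_distrr -big_split; apply: eq_bigr => i _ /=.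
  by case: (P i) => _ _ ->; rewrite mulnDr mulnCA.
exists (fun i => Q * a i + c i).
  by move=> i; apply/lacunary_digit => //; exists (a i), (c i).
by rewrite big_distrr -big_split; apply: eq_bigr => i _ /=; rewrite mulnDr mulnCA.
Qed.

(** The [(q ^ k) ^ h = Q ^ k] vectors of spread integers with [k] digits have distinct values, by
    separation. *)
Lemma lacunary_form_many (p d h k : nat) (b : 'I_h -> nat) (w : 'I_h -> 'I_h) :
  prime p -> 0 < d -> 0 < h -> (forall i, 0 < b i) -> injective w ->
  (forall i, logn p (b i) = w i * d %[mod h * d]) ->
  let Q := p ^ (h * d) in
  exists f : 'I_(Q ^ k) -> nat, injective f /\
    forall j, form_values b (lacunary (p ^ d) Q) (f j) /\
              f j < (\sum_(i < h) b i) * Q ^ k.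
Proof.
move=> p_pr d_gt0 h_gt0 b_gt0 w_inj vb Q; set q := p ^ d.
have p_gt0 := prime_gt0 p_pr.
have q_gt0 : 0 < q by rewrite expn_gt0 p_gt0.
have leqQ : q <= Q by rewrite leq_pexp2l // leq_pmull.
have cardQ : Q ^ k = #|{ffun 'I_h -> 'I_(q ^ k)}|.
  by rewrite card_ffun !card_ord /q /Q -!expnM; congr (p ^ _); lia.
pose n j : {ffun 'I_h -> 'I_(q ^ k)} := enum_val (cast_ord cardQ j).
exists (fun j => \sum_(i < h) b i * spread q Q k (n j i)); split=> [j1 j2 eqf|j].
  apply/(@cast_ord_inj _ _ cardQ)/enum_val_inj/ffunP => i; apply: val_inj => /=.
  apply: (spread_inj q_gt0 leqQ (ltn_ord _) (ltn_ord _)).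
  apply: (separated_linear_form_inj p_pr d_gt0 b_gt0 w_inj vb
            (fun=> lacunary_separated p_pr d_gt0 h_gt0)
            (x := fun i => spread q Q k (n j1 i))
            (y := fun i => spread q Q k (n j2 i))) => //.
  - by move=> i'; exists k, (n j1 i').
  - by move=> i'; exists k, (n j2 i').
split.
  by exists (fun i => spread q Q k (n j i)) => // i; exists k, (n j i).
rewrite big_distrl /= (bigD1 (Ordinal h_gt0)) // [ltnRHS](bigD1 (Ordinal h_gt0)) //=.
rewrite -addSn leq_add ?ltn_pmul2l ?spread_lt //.
by apply: leq_sum => i _; rewrite leq_mul2l ltnW ?orbT ?spread_lt.
Qed.

(** * Bounds on the representation function, and the choice of scale *)

(** Once each element of the union is assigned a piece containing it, a representation is determined
    by the pieces of its [h] coordinates. *)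
Lemma repr_fun_le_card (h n : nat) (b : 'I_h -> nat) (I : finType) (i0 : I)
    (B : I -> set nat) :
  (forall i, 0 < b i) ->
  (forall (w : 'I_h -> I) (x y : 'I_h -> nat),
     (forall i, B (w i) (x i)) -> (forall i, B (w i) (y i)) ->
     \sum_(i < h) b i * x i = \sum_(i < h) b i * y i -> x =1 y) ->
  repr_fun [set x | exists i, B i x] b n <= #|I| ^ h.
Proof.
move=> b_gt0 inj; set A := (X in repr_fun X).
have /choice [c cP] x : exists i, A x -> B i x.
  by have [[i Bx]|nAx] := pselect (A x); [exists i | exists i0].
have fin := finite_representations A n b_gt0.
rewrite /repr_fun; set X := fset_set _.
pose phi (x : {ffun 'I_h -> nat}) : {ffun 'I_h -> I} := [ffun i => c (x i)].
have uniq_phi : uniq (map phi X).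
  rewrite map_inj_in_uniq ?fset_uniq // => x y; rewrite !in_fset_set //.
  move=> /set_mem [Ax sumx] /set_mem [Ay sumy] /ffunP eq_phi; apply/ffunP.
  apply: (inj (fun i => c (x i))) => [i|i|]; first exact/cP/Ax.
    by have := eq_phi i; rewrite !ffunE => ->; exact/cP/Ay.
  by rewrite sumx sumy.
have -> : #|` X| = #|map phi X| by rewrite (card_uniqP uniq_phi) size_map.
by rewrite (leq_trans (max_card _)) // card_ffun card_ord.
Qed.

Lemma repr_fun_gt0 (h n : nat) (b x : 'I_h -> nat) (A : set nat) :
  (forall i, 0 < b i) -> (forall i, A (x i)) -> \sum_(i < h) b i * x i = n ->
  0 < repr_fun A b n.
Proof.
move=> b_gt0 Ax sumx; rewrite /repr_fun cardfs_gt0; apply/fset0Pn.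
exists [ffun i => x i]; rewrite in_fset_set; last exact: finite_representations.
apply/mem_set; split=> [i|]; first by rewrite ffunE.
by rewrite -sumx; apply: eq_bigr => i _; rewrite ffunE.
Qed.

(** The power [Q ^ k] is chosen to bring [n %/ Q ^ k] into [[G, Q * G)], where [G] is the threshold
    of [coprime_dilation]; hence [g] is bounded independently of [n]. *)
Lemma dilated_window (p Q y n : nat) : prime p -> 1 < Q -> 0 < y ->
  y * (2 * y).+1 <= n ->
  exists g k, [/\ 0 < g, coprime p g, g <= Q * (y * (2 * y).+1) &
    Q ^ k * y <= n %/ g < Q ^ k * y.+1].
Proof.
move=> p_pr Q_gt1 y_gt0; set G := y * _ => le_n.
have G_gt0 : 0 < G by rewrite muln_gt0 y_gt0.
have nG_gt0 : 0 < n %/ G by rewrite divn_gt0.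
pose k := trunc_log Q (n %/ G).
have /andP [] := trunc_log_bounds Q_gt1 nG_gt0; rewrite -/k => le_k lt_k.
have Qk_gt0 : 0 < Q ^ k by rewrite expn_gt0 ltnW.
move: le_k lt_k; rewrite leq_divRL // ltn_divLR // => le_k lt_k.
have le_w : G <= n %/ Q ^ k by rewrite leq_divRL // mulnC.
have lt_w : n %/ Q ^ k < Q * G by rewrite ltn_divLR // mulnAC -expnS.
have [g [g_gt0 cop le_g /andP [le_gy lt_gy]]] := coprime_dilation p_pr y_gt0 le_w.
exists g, k; split=> //; first exact: leq_trans le_g (ltnW lt_w).
rewrite leq_divRL // ltn_divLR //; move: le_gy lt_gy.
rewrite leq_divRL // ltn_divLR //.
by rewrite ![Q ^ k * _ * g]mulnC ![g * (_ * _)]mulnCA ![Q ^ k * (_ * _)]mulnC => -> ->.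
Qed.

Theorem corollary1p3 (h : nat) (b : 'I_h -> nat) :
  2 <= h ->
  (forall i : 'I_h, 0 < b i) ->
  \big[gcdn/0]_(i < h) b i = 1 ->
  (exists (s : {perm 'I_h}) (p d : nat),
     [/\ prime p, 1 <= d &
      forall i : 'I_h, logn p (b (s i)) = i * d %[mod h * d]]) ->
  exists (A : set nat) (C : nat),
    0 < C /\
    exists N : nat, forall n : nat, N <= n -> 1 <= repr_fun A b n <= C.
Proof.
move=> h_gt1 b_gt0 gcd1 [s [p [d [p_pr d_gt0 vbs]]]].
have h_gt0 : 0 < h := ltnW h_gt1.
have w_inj : injective (s^-1)%g := perm_inj.
have vb i : logn p (b i) = (s^-1)%g i * d %[mod h * d] by rewrite -vbs permKV.
pose q := p ^ d; pose Q := p ^ (h * d); pose U := \sum_(i < h) b i.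
have p_gt0 := prime_gt0 p_pr.
have q_gt0 : 0 < q by rewrite expn_gt0 p_gt0.
have leqQ : q <= Q by rewrite leq_pexp2l // leq_pmull.
have Q_gt1 : 1 < Q.
  by rewrite -(exp1n (h * d)) ltn_exp2r ?prime_gt1 // muln_gt0 h_gt0.
have leD e : form_values b (fun c => c < q) e -> e <= U * Q.-1.
  case=> c lt_c ->; rewrite big_distrl; apply: leq_sum => i _.
  have Q_gt0 := ltnW Q_gt1.
  by rewrite leq_mul2l -ltnS prednK // (leq_trans (lt_c i)) ?orbT.
have [y y_gt0 yP] := self_similar_syndetic_window Q_gt1
  (lacunary_form_self_similar Q b q_gt0) leD
  (fun k => lacunary_form_many k p_pr d_gt0 h_gt0 b_gt0 w_inj vb).
have [M MP] := gcd_frobenius b_gt0 gcd1.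
(* [G] bounds the dilations. [T] bounds the translates: [M], plus at most [U] multiples of [g] for
   the gap, plus a remainder modulo [g]. *)
pose G := Q * (y * (2 * y).+1); pose T := M + G * U + G.
pose B (u : 'I_G.+1 * 'I_T.+1) : set nat := [set x : nat | [/\ 0 < u.1, coprime p u.1 &
  exists2 a, lacunary q Q a & x = u.1 * a + u.2]]%classic.
exists [set x | exists u, B u x]%classic, (#|{: 'I_G.+1 * 'I_T.+1}| ^ h); split.
  by rewrite expn_gt0 card_prod !card_ord.
exists (M + y * (2 * y).+1) => n le_n; apply/andP; split; last first.
  apply: repr_fun_le_card => //; first exact: (ord0, ord0).
  move=> w x x' Bx Bx'.
  apply: (separated_linear_form_inj p_pr d_gt0 b_gt0 w_inj vb
    (A := fun i => [set x | exists2 a, lacunary q Q a & x = (w i).1 * a + (w i).2]%classic)).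
  - move=> i; have [g_gt0 cop _] := Bx i.
    exact: separated_affine (lacunary_separated p_pr d_gt0 h_gt0).
  - by move=> i; have [] := Bx i.
  - by move=> i; have [] := Bx' i.
have le_n' : y * (2 * y).+1 <= n - M by rewrite leq_subRL // (leq_trans _ le_n) ?leq_addr.
have [g [k [g_gt0 cop le_g /yP [_ [a La ->]]]]] := dilated_window p_pr Q_gt1 y_gt0 le_n'.
set S := \sum_(i < h) _; case/andP=> le_S le_U.
have lt_r := ltn_pmod (n - M) g_gt0; have eq_n := divn_eq (n - M) g.
have le_M : M <= n by apply: leq_trans le_n; exact: leq_addr.
(* The target equals [n - g * S]; the [M] set aside from [n] makes it large enough to be a value of
   the form. *)
have [|t sumt] := MP (M + ((n - M) %/ g - S) * g + (n - M) %% g).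
  by rewrite -addnA leq_addr.
have t_le i : t i < T.+1.
  have : t i <= \sum_(i < h) b i * t i.
    by rewrite (bigD1 i) //= (leq_trans (leq_pmull _ (b_gt0 i))) ?leq_addr.
  rewrite sumt ltnS => /leq_trans; apply; apply: leq_add; last first.
    by rewrite (leq_trans (ltnW lt_r)).
  by rewrite leq_add2l mulnC leq_mul // leq_subLR.
have g_lt : g < G.+1 by [].
apply: (@repr_fun_gt0 _ _ _ (fun i => g * a i + t i)) => // [i|].
  exists (Ordinal g_lt, Ordinal (t_le i)); split=> //.
  by exists (a i).
under eq_bigr do rewrite mulnDr mulnCA.
rewrite big_split -big_distrr /= -/S sumt.
move: eq_n le_S le_M; move: (_ %/ g) (_ %% g) => u v eq_n le_S le_M.
have : g * S <= u * g by rewrite mulnC leq_mul2r le_S orbT.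
by rewrite mulnBl; move: eq_n; rewrite [g * S]mulnC; lia.
Qed.
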